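(* Let $P_1$ be the uniform distribution on $[0,\frac12]$, let $P_2$ be the discrete distribution with mass $\frac13$ at each point of $D=\{\frac23,\frac56,1\}$, and let $P=\frac12P_1+\frac12P_2$. Let $\alpha$ be an optimal set of three-means for $P$. Then $\alpha=\{a_1,a_2,\frac{11}{12}\}$, where $a_1=0.191074$ and $a_2=0.573223$ when rounded to six decimal places, and the quantization error is $V_3(P)=0.0106152$ when rounded to seven decimal places.
   Context: For a Borel probability measure $Q$ on $\mathbb R$ with finite second moment and a finite nonempty set $\alpha\subset\mathbb R$, put $V(Q;\alpha)=\int\min_{a\in\alpha}(x-a)^2\,dQ(x)$ and $V_n(Q)=\inf\{V(Q;\alpha):\alpha\subset\mathbb R,\ 1\le\mathrm{card}(\alpha)\le n\}$ (the $n$th quantization error). A set $\alpha$ with $1\le\mathrm{card}(\alpha)\le n$ is an optimal set of $n$-means for $Q$ if $V(Q;\alpha)=V_n(Q)$; ''three-means'' is the case $n=3$. A real number $x$ equals a decimal $d$ when rounded to $k$ places if $|x-d|\le\frac12\cdot10^{-k}$. *)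

(* Defs.v *)
From HB Require Import structures.
From mathcomp Require Import all_boot all_order all_algebra finmap.
From mathcomp Require Import mathcomp_extra boolp classical_sets functions.
From mathcomp Require Import reals ereal interval_inference measure.
From mathcomp Require Import lebesgue_measure lebesgue_integral probability.
From mathcomp Require Import ring lra.

Set Implicit Arguments.
Unset Strict Implicit.
Unset Printing Implicit Defensive.

Import Order.TTheory GRing.Theory Num.Theory.

Local Open Scope classical_set_scope.
Local Open Scope ring_scope.

Section quantization.
Context {R : realType}.
Implicit Types (Q : probability (measurableTypeR R) R) (alpha : {fset R}).

(* The neutral element +oo of the minimum is never attained when [alpha] is
   nonempty.  All integrals are of nonnegative extended-real functions, so no
   second-moment assumption on [Q] is needed for them to make sense. *)
Definition distortion Q alpha : \bar R :=
  (\int[Q]_x \big[Order.min/+oo]_(a <- alpha) ((x - a) ^+ 2)%:E)%E.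

Definition admissible (n : nat) : set {fset R} :=
  [set alpha | (1 <= #|` alpha| <= n)%N].

Definition quantization_error (n : nat) Q : \bar R :=
  ereal_inf [set distortion Q alpha | alpha in admissible n].

Definition optimal_means (n : nat) Q alpha : Prop :=
  admissible n alpha /\ distortion Q alpha = quantization_error n Q.

End quantization.

Section rounding.
Context {R : realType}.

(* The decimal 0.d_1d_2...d_k with digits [d_1; ...; d_k]; large numerals are
   avoided because they are unary. *)
Definition decimal (d : seq nat) : R :=
  \sum_(i < size d) (nth 0%N d i)%:R / 10 ^+ i.+1.

Definition rounds_to (k : nat) (x d : R) : Prop := `|x - d| <= 2^-1 / 10 ^+ k.

End rounding.

Section mixture.
Context {R : realType}.

Lemma half_gt0 : 0 < 2^-1 :> R. Proof. lra. Qed.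

Definition P1 : probability (measurableTypeR R) R := uniform_prob half_gt0.

Definition D : seq R := [:: 2 / 3; 5 / 6; 1].

Definition P2_measure : set (measurableTypeR R) -> \bar R :=
  mscale (3^-1)%:nng
    (msum (fun k => \d_(nth 0 D k : measurableTypeR R)) (size D)).

HB.instance Definition _ := Measure.on P2_measure.

Let P2_setT : P2_measure [set: _] = 1%E.
Proof.
rewrite /P2_measure /mscale/= /msum !big_ord_recr big_ord0 /= !diracT.
by rewrite add0e -!EFinD -EFinM; congr EFin => /=; lra.
Qed.

HB.instance Definition _ := Measure_isProbability.Build _ _ _ P2_measure P2_setT.

Definition P2 : probability (measurableTypeR R) R := P2_measure.

Definition P_measure : set (measurableTypeR R) -> \bar R :=
  measure_add (mscale (2^-1)%:nng P1) (mscale (2^-1)%:nng P2).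

HB.instance Definition _ := Measure.on P_measure.

Let P_setT : P_measure [set: _] = 1%E.
Proof.
have half (Q : probability (measurableTypeR R) R) :
    mscale (2^-1)%:nng Q [set: _] = (2^-1)%:E.
  by rewrite -[RHS]mule1 -(probability_setT Q).
rewrite /P_measure measure_addE.
transitivity ((2^-1)%:E + (2^-1)%:E : \bar R)%E.
  by congr (_ + _)%E; exact: half.
by rewrite -EFinD; congr EFin; lra.
Qed.

HB.instance Definition _ := Measure_isProbability.Build _ _ _ P_measure P_setT.

Definition P : probability (measurableTypeR R) R := P_measure.

End mixture.

Arguments D R : clear implicits.
Arguments P1 R : clear implicits.
Arguments P2 R : clear implicits.
Arguments P R : clear implicits.

(* Main.v *)
Require Import Defs.
From mathcomp Require Import all_boot all_order all_algebra finmap.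
From mathcomp Require Import boolp classical_sets functions.
From mathcomp Require Import reals ereal measure lebesgue_measure probability.
From mathcomp Require Import interval_inference topology normedtype realfun.
From mathcomp Require Import derive ftc measurable_realfun lebesgue_integral.
From mathcomp Require Import ring lra.

(* On [0, 1/2] the density of P is 1, so if a mean a serves the interval [p, q]
   there, it contributes
     cell a p q = (q - p)^3 / 12 + (q - p) (a - (p + q) / 2)^2.
   For means a <= b <= c the nearest-mean regions are cut out by (a + b) / 2 and
   (b + c) / 2.  Unless c serves exactly {5/6, 1} and b serves 2/3, the
   distortion exceeds 1/90.  In the remaining case let [0, u] be served by a and
   [u, 1/2] by b, and let r = sqrt 2 and w = 1/2 - u.  Completing squares in a,
   b and c and then putting z = 6 w, the excess of the distortion over
   (6 - r) / 432 is a sum of squares plus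
     (z - r / 2)^2 (4 z + 4 r - 2) / (864 (z + 1)),
   so the minimum (6 - r) / 432 is attained only at w = r / 12,
   a = 1/4 - r / 24, b = 3/4 - r / 8, c = 11/12. *)

Set Implicit Arguments.
Unset Strict Implicit.
Unset Printing Implicit Defensive.

Import Order.TTheory GRing.Theory Num.Theory numFieldNormedType.Exports.

Local Open Scope fset_scope.
Local Open Scope ring_scope.

(** * Quadratic cost estimates for each way of serving the three atoms *)

Section cells.
Context {R : realFieldType}.
Implicit Types a b c p q u v : R.

Definition cell a p q : R := ((q - a) ^+ 3 - (p - a) ^+ 3) / 3.

Lemma cellE a p q :
  cell a p q = (q - p) ^+ 3 / 12 + (q - p) * (a - (p + q) / 2) ^+ 2.
Proof. by rewrite /cell; field. Qed.

Lemma cell_ge a p q : p <= q -> (q - p) ^+ 3 / 12 <= cell a p q.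
Proof.
by move=> pq; rewrite cellE lerDl mulr_ge0 ?subr_ge0 ?sqr_ge0.
Qed.

(** The quadratic on the right is least at a = 17/48, with value 37/1152. *)
Lemma far_first_mean_gt a : 90^-1 < cell a 0 (1 / 2) + (2 / 3 - a) ^+ 2 / 6.
Proof. by have := sqr_ge0 (a - 17 / 48); rewrite cellE; nra. Qed.

(** Two cells on [0, v] cost at least v^3 / 48, the value for equal halves. With w = 1/2 - v, the
    part served by c costs at least w / 18 + 1/108. The sum is least at w = 0, where it is 1/384 +
    1/108. *)
Lemma D_in_one_cell_gt a b c u v : 0 <= u -> u <= v -> v <= 1 / 2 ->
  90^-1 < cell a 0 u + cell b u v + cell c v (1 / 2)
          + ((2 / 3 - c) ^+ 2 + (5 / 6 - c) ^+ 2 + (1 - c) ^+ 2) / 6.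
Proof.
move=> u0 uv v2.
have := cell_ge a u0; have := cell_ge b uv; rewrite subr0 => hb ha.
have huv : v ^+ 3 / 48 <= u ^+ 3 / 12 + (v - u) ^+ 3 / 12.
  rewrite -subr_ge0 [leRHS](_ : _ = v * (2 * u - v) ^+ 2 / 16); last by field.
  by apply: divr_ge0 => //; apply: mulr_ge0; [lra | exact: sqr_ge0].
pose w := 1 / 2 - v.
have w0 : 0 <= w by rewrite /w; lra.
have w2 : w <= 1 / 2 by rewrite /w; lra.
have hc : w / 18 + 108^-1 <= cell c v (1 / 2)
    + ((2 / 3 - c) ^+ 2 + (5 / 6 - c) ^+ 2 + (1 - c) ^+ 2) / 6.
  (* Here x and y compare c with the midpoint of [v, 1/2] and with the mean 5/6 of the atoms. These
     centers are at least 1/3 apart, so x^2 + y^2 >= 1/18; since w <= 1/2, the atoms' term y^2 / 2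
     dominates w y^2. *)
  rewrite cellE -/w; pose x := c - (1 - w) / 2; pose y := 5 / 6 - c.
  have -> : c - (v + 1 / 2) / 2 = x by rewrite /x /w; field.
  have hxy : 1 / 3 <= x + y by rewrite /x /y; lra.
  have -> : ((2 / 3 - c) ^+ 2 + (5 / 6 - c) ^+ 2 + (1 - c) ^+ 2) / 6
     = 108^-1 + y ^+ 2 / 2 by rewrite /y; field.
  have hy : w * y ^+ 2 <= y ^+ 2 / 2 by have := sqr_ge0 y; nra.
  have hs : 1 / 18 <= x ^+ 2 + y ^+ 2 by have := sqr_ge0 (x - y); nra.
  have hw : w * (1 / 18) <= w * (x ^+ 2 + y ^+ 2) by exact: ler_wpM2l.
  have hw3 : 0 <= w ^+ 3 by exact: exprn_ge0.
  lra.
have hv : 384^-1 <= v ^+ 3 / 48 + w / 18.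
  have vE : v = 1 / 2 - w by rewrite /w opprB addrC subrK.
  rewrite vE -subr_ge0.
  rewrite [leRHS](_ : _ = w * (23 / 576 + w * (3 / 2 - w) / 48)); last by field.
  apply: mulr_ge0; first exact: w0.
  apply: addr_ge0; first by lra.
  by apply: divr_ge0; [apply: mulr_ge0; lra | lra].
lra.
Qed.

(** The atom 1 is dropped. The atoms 2/3 and 5/6 act as mass 1/3 at 3/4 plus their spread 1/432;
    combining this with mass w at the midpoint m of [u, 1/2] gives the optimal b. The resulting
    bound is least at w = 0, where it is 1/96 + 1/432. *)
Lemma D_in_two_cells_gt a b u : 0 <= u -> u <= 1 / 2 ->
  90^-1 < cell a 0 u + cell b u (1 / 2)
          + ((2 / 3 - b) ^+ 2 + (5 / 6 - b) ^+ 2) / 6.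
Proof.
move=> u0 u2; have := cell_ge a u0; rewrite subr0 => ha.
pose w := 1 / 2 - u.
have w0 : 0 <= w by rewrite /w; lra.
have uE : u = 1 / 2 - w by rewrite /w; lra.
pose m := (1 - w) / 2.
have hb : w ^+ 3 / 12 + 432^-1 + w * (1 + 2 * w) ^+ 2 / (16 * (3 * w + 1))
    <= cell b u (1 / 2) + ((2 / 3 - b) ^+ 2 + (5 / 6 - b) ^+ 2) / 6.
  rewrite cellE -/w -subr_ge0.
  rewrite [leRHS](_ : _ = (3 * w + 1) / 3
      * (b - (3 * w * m + 3 / 4) / (3 * w + 1)) ^+ 2).
    by apply: mulr_ge0; [lra | exact: sqr_ge0].
  by rewrite uE /m; field; lra.
have hw : 96^-1 <= u ^+ 3 / 12 + w ^+ 3 / 12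
    + w * (1 + 2 * w) ^+ 2 / (16 * (3 * w + 1)).
  rewrite uE -subr_ge0.
  rewrite [leRHS](_ : _ = w ^+ 2 * (3 + 10 * w) / (16 * (3 * w + 1))).
    by apply: divr_ge0; [apply: mulr_ge0; [exact: sqr_ge0 | lra] | lra].
  by field; lra.
lra.
Qed.

(** * The remaining configuration and its exact minimum *)

Definition two_three_cells a b c u : R := cell a 0 u + cell b u (1 / 2)
  + ((2 / 3 - b) ^+ 2 + (5 / 6 - c) ^+ 2 + (1 - c) ^+ 2) / 6.

Context (r : R) (r_ge0 : 0 <= r) (r_sqr : r ^+ 2 = 2).

Lemma two_three_cellsE a b c u (w := 1 / 2 - u) : 0 <= u -> u <= 1 / 2 ->
  two_three_cells a b c u = (6 - r) / 432 + (u * (a - u / 2) ^+ 2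
    + (w + 1 / 6) * (b - (w * (1 - w) / 2 + 1 / 9) / (w + 1 / 6)) ^+ 2
    + (c - 11 / 12) ^+ 2 / 3
    + (6 * w - r / 2) ^+ 2 * (24 * w + 4 * r - 2) / (864 * (6 * w + 1))).
Proof.
move=> u0 u2.
(* The multiple of r^2 - 2 is split off and vanishes; what is left is linear in r, and the identity
   then holds with r as a free variable. *)
have -> : (6 * w - r / 2) ^+ 2 * (24 * w + 4 * r - 2)
    = 4 * (6 * w) ^+ 3 - 2 * (6 * w) ^+ 2 - 6 * (6 * w) + 2 * r * (6 * w)
      - 1 + 2 * r + (r ^+ 2 - 2) * (- 3 * (6 * w) + r - 1 / 2) by field.
rewrite r_sqr subrr mul0r addr0 /two_three_cells !cellE /w; field; lra.
Qed.

Lemma root2_gt1 : 1 < r.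
Proof. by rewrite -(@ltr_pXn2r _ 2) ?nnegrE// r_sqr expr1n ltr1n. Qed.

(* Both bounds are continued-fraction convergents of sqrt 2. *)
Lemma root2_bounds : 1393 / 985 < r /\ r < 3363 / 2378.
Proof.
have r0 : r \is Num.nneg by rewrite nnegrE.
by split; rewrite -(@ltr_pXn2r _ 2 isT) ?r0 ?nnegrE ?r_sqr; try lra.
Qed.

Lemma two_three_cells_min a b c u : 0 <= u -> u <= 1 / 2 ->
  (6 - r) / 432 <= two_three_cells a b c u /\
  (two_three_cells a b c u <= (6 - r) / 432 ->
   [/\ a = 1 / 4 - r / 24, b = 3 / 4 - r / 8 & c = 11 / 12]).
Proof.
move=> u0 u2; rewrite two_three_cellsE//; set w := 1 / 2 - u.
have r1 := root2_gt1.
have w0 : 0 <= w by rewrite /w; lra.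
have uE : u = 1 / 2 - w by rewrite /w opprB addrC subrK.
clearbody w; subst u.
have w0' : 0 < w + 1 / 6 by lra.
set xa := a - _; set xb := b - _; set xc := c - _; set xw := 6 * w - _.
have ha : 0 <= (1 / 2 - w) * xa ^+ 2 by apply: mulr_ge0 => //; exact: sqr_ge0.
have hb : 0 <= (w + 1 / 6) * xb ^+ 2.
  by apply: mulr_ge0; [exact: ltW | exact: sqr_ge0].
have hc : 0 <= xc ^+ 2 / 3 by apply: divr_ge0 => //; exact: sqr_ge0.
have hw : 0 <= xw ^+ 2 * (24 * w + 4 * r - 2) / (864 * (6 * w + 1)).
  by apply: divr_ge0; [apply: mulr_ge0; [exact: sqr_ge0 | lra] | lra].
split; first lra.
move=> le_min.
(* The four summands of the excess are nonnegative with sum at most 0, so each vanishes. *)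
have /eqP : xw ^+ 2 * (24 * w + 4 * r - 2) / (864 * (6 * w + 1)) = 0 by lra.
rewrite !mulf_eq0 invr_eq0 [24 * w + _ - _ == 0]gt_eqF; last lra.
rewrite [864 * _ == 0]gt_eqF; last lra.
rewrite !orbF orbb => /eqP xw0.
have wE : w = r / 12 by move: xw0; rewrite /xw; lra.
have /eqP : (1 / 2 - w) * xa ^+ 2 = 0 by lra.
rewrite mulf_eq0 [_ - w == 0]gt_eqF/= ?sqrf_eq0 => [/eqP xa0|]; last first.
  by have [_] := root2_bounds; lra.
have /eqP : (w + 1 / 6) * xb ^+ 2 = 0 by lra.
rewrite mulf_eq0 gt_eqF//= sqrf_eq0 => /eqP xb0.
have /eqP : xc ^+ 2 = 0 by lra.
rewrite sqrf_eq0 => /eqP xc0.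
split.
- by move: xa0; rewrite /xa; lra.
(* At w = r / 12 the optimal b simplifies to 3/4 - r / 8: after clearing the denominator, the
   difference is a multiple of r^2 - 2. *)
- move/eqP: xb0; rewrite subr_eq0 => /eqP ->.
  apply/eqP; rewrite eq_sym -(inj_eq (mulIf (lt0r_neq0 w0'))).
  rewrite divfK ?lt0r_neq0//.
  rewrite wE -subr_eq0 [X in X == _](_ : _ = (2 - r ^+ 2) / 144); last by field.
  by rewrite r_sqr subrr mul0r.
- by move: xc0; rewrite /xc; lra.
Qed.

Lemma two_three_cells_attained :
  two_three_cells (1 / 4 - r / 24) (3 / 4 - r / 8) (11 / 12) (1 / 2 - r / 12)
    = (6 - r) / 432.
Proof.
have [_ rlt] := root2_bounds.
have r1 := root2_gt1.
have w0 : r / 12 + 1 / 6 != 0 by lra.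
rewrite two_three_cellsE; [|lra|lra].
have -> : 1 / 2 - (1 / 2 - r / 12) = r / 12 by lra.
have -> : (r / 12 * (1 - r / 12) / 2 + 1 / 9) / (r / 12 + 1 / 6)
    = 3 / 4 - r / 8.
  apply: (mulIf w0); rewrite divfK//.
  apply/eqP; rewrite -subr_eq0.
  rewrite [X in X == _](_ : _ = (r ^+ 2 - 2) / 144); last by field.
  by rewrite r_sqr subrr mul0r.
have -> : 6 * (r / 12) - r / 2 = 0 by field.
have -> : 1 / 4 - r / 24 - (1 / 2 - r / 12) / 2 = 0 by field.
by rewrite !subrr expr0n/= !mulr0 !mul0r !addr0.
Qed.

(** The minimum is about 0.01062, while the smallest of the bounds for the other configurations is
    1/384 + 1/108, about 0.01186; 1/90 lies between. *)
Lemma min_cost_lt : (6 - r) / 432 < 90^-1.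
Proof. by have [] := root2_bounds; lra. Qed.
End cells.

(** * The distortion as a sum of integrals over cells and values at atoms *)

Section distortion.
Local Open Scope classical_set_scope.
Context {R : realType}.
Local Notation mu := (@lebesgue_measure R).
Implicit Types (a b c p q s t u v x y z : R) (l : seq R) (alpha : {fset R}).

(** The integrand of [distortion], taken over sequences so that its properties follow by
    induction. *)
Definition sqdist (l : seq R) (x : R) : \bar R :=
  \big[Order.min/+oo%E]_(a <- l) ((x - a) ^+ 2)%:E.

Lemma measurable_sqr (a : R) :
  measurable_fun setT (fun x : measurableTypeR R => (x - a) ^+ 2).
Proof. by apply: measurable_funX; exact: measurable_funB. Qed.

Lemma measurable_sqdist l :
  measurable_fun setT (sqdist l : measurableTypeR R -> \bar R).
Proof.
elim: l => [|a l ih].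
  rewrite (_ : sqdist [::] = cst +oo%E); first exact: measurable_cst.
  by apply/funext => x; rewrite /sqdist big_nil.
rewrite (_ : sqdist (a :: l) =
    fun x => Order.min ((x - a) ^+ 2)%:E (sqdist l x)); last first.
  by apply/funext => x; rewrite /sqdist big_cons.
apply: measurable_mine => //.
by apply/measurable_EFinP; exact: measurable_sqr.
Qed.

Lemma sqdist_ge0 l x : (0 <= sqdist l x)%E.
Proof.
rewrite /sqdist; elim/big_ind : _ => //= [y z y0 z0|a _].
  by rewrite le_min y0.
by rewrite lee_fin sqr_ge0.
Qed.

(** Half of the uniform density 2 is density 1, and half of 1/3 is mass 1/6 at each atom. *)
Lemma distortionE alpha : distortion (P R) alpha =
  (\int[mu]_(x in `[0%R, (1 / 2)%R]) sqdist alpha x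
   + (6^-1)%:E * (sqdist alpha (2 / 3)%R + sqdist alpha (5 / 6)%R
                  + sqdist alpha 1%R))%E.
Proof.
have m := measurable_sqdist alpha.
have m0 x (_ : setT x) := sqdist_ge0 alpha x.
rewrite /distortion -/(sqdist alpha).
rewrite div1r ge0_integral_measure_add// !ge0_integral_mscale//.
rewrite integral_uniform//; last by move=> x; exact: m0.
rewrite ge0_integral_measure_sum// !big_ord_recr big_ord0 /=.
rewrite !integral_dirac// !diracT !mul1e add0e subr0 invrK !muleA -!EFinM.
rewrite mulVf// mul1e; congr (_ + _%:E * _)%E.
by field.
Qed.

Lemma integral_sqr a p q : p <= q ->
  (\int[mu]_(x in `[p, q]) ((x - a) ^+ 2)%:E = (cell a p q)%:E)%E.
Proof.
(* A one-point interval is null; the fundamental theorem of calculus covers p < q. *)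
rewrite le_eqVlt => /predU1P[->|pq].
  by rewrite set_itv1 integral_set1 /cell subrr mul0r.
pose F := fun x : R => (x - a) ^+ 3 / 3.
have dF (x : R) : is_derive x 1 F ((x - a) ^+ 2).
  rewrite /F; apply: is_derive_eq.
  by rewrite /GRing.scale/=; field.
have cF : continuous F.
  by move=> x; apply: differentiable_continuous; exact/derivable1_diffP.
rewrite (@continuous_FTC2 _ _ F)//.
- by rewrite -EFinB /F /cell mulrBl.
- apply: continuous_subspaceT => x; apply: differentiable_continuous.
  exact/derivable1_diffP.
- split => //; [exact/cvg_at_right_filter/cF | exact/cvg_at_left_filter/cF].
- by move=> x _; rewrite derive1E; exact: derive_val.
Qed.

Lemma integral_itv_split (f : R -> \bar R) p q s : p <= q -> q <= s ->
  measurable_fun setT (f : measurableTypeR R -> \bar R) ->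
  (forall x, 0 <= f x)%E ->
  (\int[mu]_(x in `[p, s]) f x =
   \int[mu]_(x in `[p, q]) f x + \int[mu]_(x in `[q, s]) f x)%E.
Proof.
move=> pq qs mf f0.
rewrite -(@integral_itv_bndo_bndc _ _ q); last exact: measurable_funTS.
rewrite (@itv_bndbnd_setU _ _ _ (BLeft q)) ?bnd_simp// ge0_integral_setU//.
- exact: measurable_funTS.
- apply/disj_setPS => x [] /=; rewrite !in_itv/= => /andP[_ xq] /andP[qx _].
  by move: xq; rewrite ltNge qx.
Qed.

Lemma sqdist_le l a x : a \in l -> (sqdist l x <= ((x - a) ^+ 2)%:E)%E.
Proof.
rewrite /sqdist; elim: l => //= b l ih; rewrite inE big_cons ge_min.
by move=> /predU1P[->|/ih ->]; rewrite ?lexx ?orbT.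
Qed.

Lemma le_sqdist l x y :
  (forall a, a \in l -> y <= (x - a) ^+ 2) -> (y%:E <= sqdist l x)%E.
Proof.
rewrite /sqdist => h; rewrite big_seq.
elim/big_ind : _ => [|? ? ? ?|a /h]; rewrite ?leey ?le_min ?lee_fin//.
exact/andP.
Qed.

Lemma mem_fset3 a b c x : (x \in [fset a; b; c]) = [|| x == a, x == b | x == c].
Proof. by rewrite !inE orbA. Qed.

Lemma distortion_three_cells alpha u v : 0 <= u -> u <= v -> v <= 1 / 2 ->
  distortion (P R) alpha =
  (\int[mu]_(x in `[0%R, u]) sqdist alpha x
   + (\int[mu]_(x in `[u, v]) sqdist alpha x
      + \int[mu]_(x in `[v, (1 / 2)%R]) sqdist alpha x)
   + (6^-1)%:E * (sqdist alpha (2 / 3)%R + sqdist alpha (5 / 6)%R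
                  + sqdist alpha 1%R))%E.
Proof.
move=> u0 uv v2; rewrite distortionE.
rewrite (@integral_itv_split _ 0 u (1 / 2)) ?(le_trans uv)//;
  [|exact: measurable_sqdist|exact: sqdist_ge0].
by rewrite (@integral_itv_split _ u v (1 / 2))//;
  [exact: measurable_sqdist|exact: sqdist_ge0].
Qed.

(** Endpoints are null, so the comparison is asked only on the open interval and is vacuous for an
    empty cell. *)
Lemma integral_sqdist_ge alpha a p q : p <= q ->
  (forall t, p < t < q -> (((t - a) ^+ 2)%:E <= sqdist alpha t)%E) ->
  ((cell a p q)%:E <= \int[mu]_(x in `[p, q]) sqdist alpha x)%E.
Proof.
move=> pq h; rewrite -integral_sqr// !(@integral_itv_bndoo _ _ _ _ true false);
  last 2 first.
- by apply: measurable_funTS; exact: measurable_sqdist.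
- by apply/measurable_EFinP; apply: measurable_funTS; exact: measurable_sqr.
apply: ge0_le_integral => //=.
- by move=> x _; rewrite lee_fin sqr_ge0.
- by apply/measurable_EFinP; apply: measurable_funTS; exact: measurable_sqr.
- by apply: measurable_funTS; exact: measurable_sqdist.
Qed.

Lemma integral_sqdist_le alpha a p q : p <= q -> a \in alpha ->
  (\int[mu]_(x in `[p, q]) sqdist alpha x <= (cell a p q)%:E)%E.
Proof.
move=> pq aalpha; rewrite -integral_sqr//; apply: ge0_le_integral => //=.
- by move=> x _; exact: sqdist_ge0.
- by apply: measurable_funTS; exact: measurable_sqdist.
- by apply/measurable_EFinP; apply: measurable_funTS; exact: measurable_sqr.
- by move=> x _; exact: sqdist_le.
Qed.

(** The bounds x, y, z at the atoms are left free: each case chooses the mean serving an atom, or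
    takes 0 to discard the atom. *)
Lemma distortion_ge alpha a b c u v x y z : 0 <= u -> u <= v -> v <= 1 / 2 ->
  (forall t, 0 < t < u -> (((t - a) ^+ 2)%:E <= sqdist alpha t)%E) ->
  (forall t, u < t < v -> (((t - b) ^+ 2)%:E <= sqdist alpha t)%E) ->
  (forall t, v < t < 1 / 2 -> (((t - c) ^+ 2)%:E <= sqdist alpha t)%E) ->
  (x%:E <= sqdist alpha (2 / 3)%R)%E -> (y%:E <= sqdist alpha (5 / 6)%R)%E ->
  (z%:E <= sqdist alpha 1%R)%E ->
  ((cell a 0 u + cell b u v + cell c v (1 / 2) + (x + y + z) / 6)%:E
    <= distortion (P R) alpha)%E.
Proof.
move=> u0 uv v2 ha hb hc hx hy hz; rewrite (@distortion_three_cells _ u v)//.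
rewrite [X in X%:E](_ : _ = cell a 0 u + (cell b u v + cell c v (1 / 2))
  + 6^-1 * (x + y + z)); last by rewrite [X in _ + X]mulrC !addrA.
rewrite EFinD EFinM !EFinD.
apply: leeD.
  by apply: leeD; [|apply: leeD]; apply: integral_sqdist_ge.
apply: lee_wpmul2l; first by rewrite lee_fin.
by apply: leeD => //; apply: leeD.
Qed.

(** * Nearest-mean regions of a sorted triple *)

Lemma sqr_dist_le a b t : a <= b -> t <= (a + b) / 2 ->
  (t - a) ^+ 2 <= (t - b) ^+ 2.
(* The difference (t - b)^2 - (t - a)^2 equals (b - a) (a + b - 2 t). *)
Proof. by move=> ab tab; nra. Qed.

Lemma sqr_dist_ge a b t : a <= b -> (a + b) / 2 <= t ->
  (t - b) ^+ 2 <= (t - a) ^+ 2.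
Proof. by move=> ab tab; nra. Qed.

Lemma sqdist_ge_first a b c t : a <= b -> b <= c -> t <= (a + b) / 2 ->
  (((t - a) ^+ 2)%:E <= sqdist [fset a; b; c] t)%E.
Proof.
move=> ab bc tab; apply: le_sqdist => d.
rewrite mem_fset3 => /or3P[] /eqP -> //.
- exact: sqr_dist_le.
- by apply: sqr_dist_le; lra.
Qed.

Lemma sqdist_ge_second a b c t : a <= b -> b <= c ->
  (a + b) / 2 <= t -> t <= (b + c) / 2 ->
  (((t - b) ^+ 2)%:E <= sqdist [fset a; b; c] t)%E.
Proof.
move=> ab bc tab tbc.
apply: le_sqdist => d; rewrite mem_fset3 => /or3P[] /eqP -> //.
- exact: sqr_dist_ge.
- exact: sqr_dist_le.
Qed.

Lemma sqdist_ge_third a b c t : a <= b -> b <= c -> (b + c) / 2 <= t ->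
  (((t - c) ^+ 2)%:E <= sqdist [fset a; b; c] t)%E.
Proof.
move=> ab bc tab.
apply: le_sqdist => d; rewrite mem_fset3 => /or3P[] /eqP -> //.
- by apply: sqr_dist_ge; lra.
- exact: sqr_dist_ge.
Qed.

(** Clamping x to [lo, hi] turns a midpoint of two means into a cut inside the interval; if x lies
    outside, one of the two conditions becomes vacuous. *)
Lemma clip_itv (x lo hi : R) : lo <= hi -> exists u,
  [/\ lo <= u <= hi, forall t, lo < t < u -> t <= x
    & forall t, u < t < hi -> x <= t].
Proof.
move=> lohi; have [xlo|lox] := leP x lo.
  exists lo; split => [|t|t /andP[lot _]]; first by rewrite lexx.
    by case/andP=> lot /(lt_trans lot); rewrite ltxx.
  exact: le_trans xlo (ltW lot).
have [xhi|hix] := leP x hi.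
  by exists x; split=> [|t /andP[_ /ltW]//|t /andP[/ltW]//]; rewrite ltW.
exists hi; split => [|t /andP[_ thi]|t]; first by rewrite lexx andbT.
  exact: le_trans (ltW thi) (ltW hix).
by case/andP=> hit /(lt_trans hit); rewrite ltxx.
Qed.

Lemma distortion_cases a b c (alpha := [fset a; b; c]) : a <= b -> b <= c ->
  ((90^-1)%:E < distortion (P R) alpha)%E \/
  exists2 u, 0 <= u <= 1 / 2 &
    ((two_three_cells a b c u)%:E <= distortion (P R) alpha)%E.
Proof.
move=> ab bc.
(* First case: a serves all of [0, 1/2] and also 2/3. The two other cells are empty, and 5/6 and 1
   are discarded. *)
have [s23|s23] := leP (2 / 3) ((a + b) / 2).
  suff : ((cell a 0 (1 / 2) + cell a (1 / 2) (1 / 2) + cell a (1 / 2) (1 / 2)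
      + ((2 / 3 - a) ^+ 2 + 0 + 0) / 6)%:E <= distortion (P R) alpha)%E.
    move=> h; left; apply: lt_le_trans h; rewrite lte_fin.
    by have := far_first_mean_gt a; rewrite /cell; lra.
  apply: distortion_ge => //.
  - by move=> t /andP[_ ?]; apply: sqdist_ge_first => //; lra.
  - by move=> t /andP[_ ?]; apply: sqdist_ge_first => //; lra.
  - by move=> t /andP[_ ?]; apply: sqdist_ge_first => //; lra.
  - exact: sqdist_ge_first.
  - exact: sqdist_ge0.
  - exact: sqdist_ge0.
(* Second case: c serves every atom and possibly an end piece [v, 1/2]. *)
have [t12|t12] := leP ((b + c) / 2) (1 / 2).
  have [v [/andP[v0 v2] tv vt]] : exists v, [/\ 0 <= v <= 1 / 2,
      forall t, 0 < t < v -> t <= (b + c) / 2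
      & forall t, v < t < 1 / 2 -> (b + c) / 2 <= t] by apply: clip_itv; lra.
  have [u [/andP[u0 uv] tu ut]] := clip_itv ((a + b) / 2) v0.
  have := D_in_one_cell_gt a b c u0 uv v2; rewrite -lte_fin => lt_dist.
  left; apply: lt_le_trans lt_dist _; apply: distortion_ge => //.
  - by move=> t /tu; exact: sqdist_ge_first.
  - move=> t /[dup] /andP[ut' tv'] /ut h; apply: sqdist_ge_second => //.
    by apply: tv; rewrite tv' (le_lt_trans u0 ut').
  - by move=> t /vt; exact: sqdist_ge_third.
  - by apply: sqdist_ge_third => //; lra.
  - by apply: sqdist_ge_third => //; lra.
  - by apply: sqdist_ge_third => //; lra.
(* From here on c serves nothing in [0, 1/2], so its cell is the empty one at v = 1/2 and only the
   atoms remain to be assigned. *)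
have [u [/andP[u0 u2] tu ut]] : exists u, [/\ 0 <= u <= 1 / 2,
    forall t, 0 < t < u -> t <= (a + b) / 2
    & forall t, u < t < 1 / 2 -> (a + b) / 2 <= t] by apply: clip_itv; lra.
have dist_ge x y z : (x%:E <= sqdist alpha (2 / 3)%R)%E ->
    (y%:E <= sqdist alpha (5 / 6)%R)%E -> (z%:E <= sqdist alpha 1%R)%E ->
    ((cell a 0 u + cell b u (1 / 2) + (x + y + z) / 6)%:E
      <= distortion (P R) alpha)%E.
  have -> : cell a 0 u + cell b u (1 / 2)
      = cell a 0 u + cell b u (1 / 2) + cell c (1 / 2) (1 / 2).
    by rewrite [cell c _ _]/cell subrr mul0r addr0.
  move=> hx hy hz; apply: distortion_ge => //.
  - by move=> t /tu; exact: sqdist_ge_first.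
  - by move=> t /[dup] /andP[_ ?] /ut h; apply: sqdist_ge_second => //; lra.
  - by move=> t /andP[/lt_trans/[apply]]; rewrite ltxx.
(* If (b + c) / 2 <= 2/3, all atoms still go to c. *)
have [t23|t23] := leP ((b + c) / 2) (2 / 3).
  have := D_in_one_cell_gt a b c u0 u2 (lexx _).
  rewrite [cell c _ _]/cell subrr mul0r addr0 -lte_fin => lt_dist.
  left; apply: lt_le_trans lt_dist _; apply: dist_ge.
  - by apply: sqdist_ge_third => //; lra.
  - by apply: sqdist_ge_third => //; lra.
  - by apply: sqdist_ge_third => //; lra.
(* Between 2/3 and 5/6 the midpoint leaves 2/3 to b and the other two atoms to c; beyond 5/6, b
   serves both 2/3 and 5/6. *)
have [t56|t56] := leP ((b + c) / 2) (5 / 6).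
  right; exists u; first by rewrite u0.
  apply: dist_ge.
  - by apply: sqdist_ge_second => //; lra.
  - by apply: sqdist_ge_third => //; lra.
  - by apply: sqdist_ge_third => //; lra.
have := D_in_two_cells_gt a b u0 u2.
rewrite -[_ ^+ 2 + _]addr0 -lte_fin => lt_dist.
left; apply: lt_le_trans lt_dist _; apply: dist_ge.
- by apply: sqdist_ge_second => //; lra.
- by apply: sqdist_ge_second => //; lra.
- exact: sqdist_ge0.
Qed.

(** * Admissible sets as sorted triples *)

Lemma card_fset3 a b c : (1 <= #|` [fset a; b; c]| <= 3)%N.
Proof.
by rewrite fsetUC cardfsU1 cardfs2; case: (_ \notin _); case: (_ != _).
Qed.

(** Sets with fewer than three points become triples with repetitions, which is why the order is not
    strict. *)
Lemma fset_sorted_triple alpha : (1 <= #|` alpha| <= 3)%N ->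
  exists a b c, [/\ a <= b, b <= c & alpha = [fset a; b; c]].
Proof.
move=> h.
have : sorted <=%O (sort <=%O alpha : seq R).
  by apply: sort_sorted; exact: le_total.
have aE x : (x \in alpha) = (x \in sort <=%O (alpha : seq R)).
  by rewrite mem_sort.
have : (1 <= size (sort <=%O (alpha : seq R)) <= 3)%N.
  by rewrite size_sort; exact: h.
case: sort aE => [|a [|b [|c [|]]]]//= aE _.
- exists a, a, a; split => //.
  by apply/fsetP => x; rewrite mem_fset3 aE !inE !orbb.
- rewrite andbT => ab; exists a, b, b; split => //.
  by apply/fsetP => x; rewrite mem_fset3 aE !inE !orbb.
- rewrite andbT => /andP[ab bc]; exists a, b, c; split => //.
  by apply/fsetP => x; rewrite mem_fset3 aE !inE.
Qed.

(** * The minimum and its unique minimizer *)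

Local Notation r := (Num.sqrt 2 : R).

Let r_ge0 : 0 <= r. Proof. exact: sqrtr_ge0. Qed.
Let r_sqr : r ^+ 2 = 2. Proof. exact: sqr_sqrtr. Qed.

Lemma admissible_distortion_ge alpha : admissible 3 alpha ->
  (((6 - r) / 432)%:E <= distortion (P R) alpha)%E.
Proof.
move=> /fset_sorted_triple[a [b [c [ab bc ->]]]].
have [lt_dist|[u /andP[u0 u2]]] := distortion_cases ab bc.
  apply: le_trans (ltW lt_dist); rewrite lee_fin ltW//.
  exact: min_cost_lt r_ge0 r_sqr.
apply: le_trans; rewrite lee_fin.
by have [] := two_three_cells_min r_ge0 r_sqr a b c u0 u2.
Qed.

Lemma distortion_le_optimal alpha : admissible 3 alpha ->
  (distortion (P R) alpha <= ((6 - r) / 432)%:E)%E ->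
  alpha = [fset 1 / 4 - r / 24; 3 / 4 - r / 8; 11 / 12].
Proof.
move=> /fset_sorted_triple[a [b [c [ab bc ->]]]] le_dist.
have [/lt_le_trans/(_ le_dist)|[u /andP[u0 u2]]] := distortion_cases ab bc.
  by rewrite lte_fin ltNge ltW// (min_cost_lt r_ge0 r_sqr).
move=> /le_trans/(_ le_dist); rewrite lee_fin.
have [_ h] := two_three_cells_min r_ge0 r_sqr a b c u0 u2.
by case/h => -> -> ->.
Qed.

(** Any assignment of means to cells and atoms bounds the distortion from above; the one used here
    is cut at u = 1/2 - r / 12, where [two_three_cells] attains its minimum. *)
Lemma distortion_optimal_le :
  (distortion (P R) [fset (1 / 4 - r / 24)%R; (3 / 4 - r / 8)%R; (11 / 12)%R]
    <= ((6 - r) / 432)%:E)%E.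
Proof.
have [rgt rlt] := root2_bounds r_ge0 r_sqr.
rewrite -(two_three_cells_attained r_ge0 r_sqr) /two_three_cells.
set a := 1 / 4 - _; set b := 3 / 4 - _; set c := 11 / 12; set u := 1 / 2 - _.
have u0 : 0 <= u by rewrite /u; lra.
have u2 : u <= 1 / 2 by rewrite /u; lra.
rewrite (@distortion_three_cells _ u (1 / 2))//.
have [ma mb mc] : [/\ a \in [fset a; b; c], b \in [fset a; b; c]
  & c \in [fset a; b; c]] by rewrite !mem_fset3 !eqxx !orbT.
rewrite set_itv1 integral_set1 adde0 EFinD EFinM !EFinD [in leRHS]muleC.
apply: leeD; first by apply: leeD; exact: integral_sqdist_le.
apply: lee_wpmul2l; first by rewrite lee_fin.
by apply: leeD; [apply: leeD|]; exact: sqdist_le.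
Qed.

Lemma quantization_error_3 : quantization_error 3 (P R) = ((6 - r) / 432)%:E.
Proof.
apply/eqP; rewrite eq_le; apply/andP; split.
  apply: le_trans distortion_optimal_le; apply: ereal_inf_lbound.
  exists [fset 1 / 4 - r / 24; 3 / 4 - r / 8; 11 / 12] => //=.
  exact: card_fset3.
by apply: le_ereal_inf_tmp => _ [alpha /admissible_distortion_ge + <-].
Qed.

End distortion.

Theorem lemma2p6p2 (R : realType) (alpha : {fset R})
    (halpha : optimal_means 3 (P R) alpha) :
  (exists a1 a2 : R,
     [/\ alpha = [fset a1; a2; 11 / 12],
         rounds_to 6 a1 (decimal [:: 1; 9; 1; 0; 7; 4]%N) &
         rounds_to 6 a2 (decimal [:: 5; 7; 3; 2; 2; 3]%N)]) /\
  (exists v : R,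
     quantization_error 3 (P R) = v%:E /\
     rounds_to 7 v (decimal [:: 0; 1; 0; 6; 1; 5; 2]%N)).
Proof.
have [adm] := halpha; rewrite quantization_error_3 => dist_eq.
(* All three quantities are affine in sqrt 2. The roundings of both means require sqrt 2 > 1.414212,
   which 1393/985 ensures and the preceding lower convergent 239/169 would not. *)
have [rgt rlt] := root2_bounds (@sqrtr_ge0 R 2) (sqr_sqrtr (ler0n R 2)).
split; last first.
  exists ((6 - Num.sqrt 2) / 432); split=> //.
  rewrite /rounds_to /decimal !big_ord_recr big_ord0/= ler_norml.
  apply/andP; split; lra.
exists (1 / 4 - Num.sqrt 2 / 24), (3 / 4 - Num.sqrt 2 / 8); split.
- by apply: distortion_le_optimal => //; rewrite dist_eq.
- rewrite /rounds_to /decimal !big_ord_recr big_ord0/= ler_norml.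
  apply/andP; split; lra.
- rewrite /rounds_to /decimal !big_ord_recr big_ord0/= ler_norml.
  apply/andP; split; lra.
Qed.
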